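(* Let $X\sim \mathrm{GH}(\lambda,\alpha,\beta,\delta,0)$, where $\alpha>\beta>0$, and let $\gamma=\sqrt{\alpha^2-\beta^2}$. Assume either that $\delta>0$ and $\lambda\in\mathbb{R}$, or that $\delta=0$ and $\lambda>1/2$. Then $$\operatorname{Med}(X)>\frac{\beta}{\gamma^2}\left[\lambda-\frac12+\sqrt{\left(\lambda-\frac12\right)^2+\delta^2\gamma^2}\right].$$
   Context: For $\lambda\in\mathbb{R}$, $\alpha>\beta>0$, $\delta>0$ and $\gamma=\sqrt{\alpha^2-\beta^2}$, the generalized hyperbolic distribution $\mathrm{GH}(\lambda,\alpha,\beta,\delta,0)$ is the distribution on $\mathbb{R}$ with density $$p(x)=\frac{(\gamma/\delta)^\lambda}{\sqrt{2\pi}K_\lambda(\delta\gamma)}e^{\beta x}\frac{K_{\lambda-1/2}\left(\alpha\sqrt{\delta^2+x^2}\right)}{\left(\sqrt{\delta^2+x^2}/\alpha\right)^{1/2-\lambda}},\qquad x\in\mathbb{R},$$ where $K_\nu$ is the modified Bessel function of the second kind. For $\delta=0$ and $\lambda>0$ the density is defined as the limit of this expression as $\delta\downarrow 0$ (using $K_\lambda(x)\sim 2^{\lambda-1}\Gamma(\lambda)x^{-\lambda}$ as $x\downarrow0$), i.e. $$p(x)=\frac{2^{1-\lambda}\gamma^{2\lambda}}{\sqrt{2\pi}\,\Gamma(\lambda)}e^{\beta x}\left(\frac{|x|}{\alpha}\right)^{\lambda-1/2}K_{\lambda-1/2}(\alpha|x|).$$ The median of a real-valued random variable $X$ is $\operatorname{Med}(X)=\inf\{x\in\mathbb{R}: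 P(X\le x)\ge 1/2\}$. *)

(* Defs.v *)
From HB Require Import structures.
From mathcomp Require Import all_boot all_order all_algebra.
From mathcomp Require Import all_classical all_reals all_analysis.
Set Implicit Arguments.
Unset Strict Implicit.
Unset Printing Implicit Defensive.
Import Order.TTheory GRing.Theory Num.Theory.
Import numFieldNormedType.Exports.
Local Open Scope classical_set_scope.
Local Open Scope ring_scope.

Definition gammaR (R : realType) (s : R) : R :=
  \int[lebesgue_measure]_(t in `]0, +oo[) (t `^ (s - 1) * expR (- t)).

Definition coshR (R : realType) (t : R) : R := (expR t + expR (- t)) / 2.

(* Modified Bessel function of the second kind K_nu(x), real order nu, x > 0,
   by its standard integral representation. The integral diverges for x <= 0,
   where the value is meaningless. *)
Definition besselK (R : realType) (nu x : R) : R :=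
  \int[lebesgue_measure]_(t in `[0, +oo[)
    (expR (- (x * coshR t)) * coshR (nu * t)).

Definition gh_gamma (R : realType) (alpha beta : R) : R :=
  Num.sqrt (alpha ^+ 2 - beta ^+ 2).

(* Density of GH(lambda, alpha, beta, delta, 0) for alpha > beta > 0 and either
   delta > 0, or delta = 0 and lambda > 0 (pointwise limit as delta tends to 0+).
   For delta = 0 the value at the single point x = 0 is irrelevant. *)
Definition gh_pdf (R : realType) (lambda alpha beta delta x : R) : R :=
  let gamma := gh_gamma alpha beta in
  if delta == 0 then
    2 `^ (1 - lambda) * gamma `^ (2 * lambda)
      / (Num.sqrt (2 * pi) * gammaR lambda)
    * expR (beta * x) * (`|x| / alpha) `^ (lambda - 1 / 2)
    * besselK (lambda - 1 / 2) (alpha * `|x|)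
  else
    (gamma / delta) `^ lambda
      / (Num.sqrt (2 * pi) * besselK lambda (delta * gamma))
    * expR (beta * x)
    * (besselK (lambda - 1 / 2) (alpha * Num.sqrt (delta ^+ 2 + x ^+ 2))
       / (Num.sqrt (delta ^+ 2 + x ^+ 2) / alpha) `^ (1 / 2 - lambda)).

Definition gh_prob (R : realType) (lambda alpha beta delta : R) :
    set _ -> \bar R :=
  fun A => (\int[lebesgue_measure]_(x in A)
              (gh_pdf lambda alpha beta delta x)%:E)%E.

Definition median (d : measure_display) (T : measurableType d) (R : realType)
    (P : probability T R) (X : {RV P >-> R}) : R :=
  inf [set x : R | ((1 / 2)%:E <= cdf X x)%E].

(* Main.v *)
Require Import Defs.
From HB Require Import structures.
From mathcomp Require Import all_boot all_order all_algebra.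
From mathcomp Require Import all_classical all_reals all_analysis.
From mathcomp Require Import measurable_realfun.
From mathcomp Require Import ring lra.
Set Implicit Arguments.
Unset Strict Implicit.
Unset Printing Implicit Defensive.
Import Order.TTheory GRing.Theory Num.Theory.
Import numFieldNormedType.Exports.
Local Open Scope classical_set_scope.
Local Open Scope ring_scope.

(** Let Z be a standard normal variable, with distribution function Phi, and
    let W be an independent variable with density proportional to w ^ (lambda
    - 1) exp (- delta^2 / (2 w) - gamma^2 w / 2). Then X has the law of beta
    W + sqrt(W) Z. The claimed bound is m = beta w, where w is the positive
    root of gamma^2 w^2 - (2 lambda - 1) w - delta^2 = 0. Write W = w exp t.
    Given t, the event X <= m is Z <= - v(t), where v(t) = 2 beta sqrt(w)
    sinh (t / 2) is odd in t. The density of t is proportional to q(t) = exp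
    (lambda t - a exp (- t) - b exp t) with a = delta^2 / (2 w) and b =
    gamma^2 w / 2, so P(X <= m) and P(X > m) are the same multiple of the
    integrals of q(t) Phi(- v(t)) and of q(t) Phi(v(t)) [gh_prob_split].
    Since the two probabilities add up to 1, it suffices that the first is
    the smaller one: then the distribution function is below 1/2 at m, and by
    right continuity also slightly beyond m [median_gt].

    With G(y) = Phi(y) - Phi(- y), folding the line at t = 0 reduces the
    claim to positivity of the integral of G(v(t)) (q(t) - q(- t)) over t > 0
    [gig_normal_lt]. The equation for w says b - a = lambda - 1/2, so that
    with c = 2 (b - a) one has ln (q(t) / q(- t)) = (c + 1) t - c sinh t. For
    c <= 0 this is positive for all t > 0 and the claim is clear. For c > 0
    it changes sign exactly once, from positive to negative, at some t0. Two
    facts then decide. On the one hand exp (- t / 2) q(t) vanishes at both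
    infinities, and integrating its derivative shows that J(t) = sinh (t / 2)
    ((b + a exp (- t)) q(t) - (b + a exp t) q(- t)) has integral 0 over t > 0
    [gig_weight_moment]. On the other hand G(y) / y is strictly decreasing,
    because G' is. As J(t) <= (a + b) sinh (t / 2) (q(t) - q(- t)), comparing
    G(v(t)) with a multiple of sinh (t / 2) that agrees with it at t0 yields
    a constant kappa with kappa J(t) < G(v(t)) (q(t) - q(- t)) for all t > 0
    other than t0 [gig_weight_pairing], and integrating this inequality
    proves the claim.

    The mixture representation comes from the integral formula for the Bessel
    function, translated so that the variable of integration becomes t
    [besselK_mixture], followed by Tonelli and, for each t, the substitution
    x = s z + beta s^2 with s = sqrt(w) exp (t / 2). The normalizing constant
    of the density is never evaluated: the law of X is given to be a
    probability, which forces the constant to be positive and the integrals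
    to be finite. *)

(** * Hyperbolic functions and the exponential *)

(** By the mean value theorem f x / x is a value of f' on ]0, x[ and
    (f y - f x) / (y - x) is a value of f' on ]x, y[, hence a smaller one. *)
Lemma ratio_decreasing (R : realType) (f f' : R -> R) (x y : R) :
  f 0 = 0 -> (forall z : R, is_derive z 1 f (f' z)) ->
  (forall u v : R, 0 < u -> u < v -> f' v < f' u) ->
  0 < x -> x < y -> f y * x < f x * y.
Proof.
move=> f0 df f'_decr x0 xy.
have cf a b : {within `[a, b], continuous f}.
  apply: continuous_subspaceT => z.
  by apply/differentiable_continuous/derivable1_diffP; case: (df z).
have [u + fxE] := MVT x0 (fun z _ => df z) (cf 0 x).
have [v + fyE] := MVT xy (fun z _ => df z) (cf x y).
rewrite !in_itv/= => /andP[xv vy] /andP[u0 ux].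
have f'vu : f' v < f' u by apply: f'_decr => //; exact: lt_trans xv.
rewrite f0 !subr0 in fxE.
have -> : f y = f x + f' v * (y - x) by rewrite -fyE; lra.
rewrite fxE -subr_gt0.
have -> : f' u * x * y - (f' u * x + f' v * (y - x)) * x =
  x * (y - x) * (f' u - f' v) by ring.
by rewrite !mulr_gt0// subr_gt0.
Qed.

Definition sinhR (R : realType) (t : R) : R := (expR t - expR (- t)) / 2.

Lemma sinhRN (R : realType) (t : R) : sinhR (- t) = - sinhR t.
Proof. by rewrite /sinhR opprK; lra. Qed.

Lemma sinhR_gt0 (R : realType) (t : R) : 0 < t -> 0 < sinhR t.
Proof.
move=> t0; rewrite /sinhR divr_gt0// subr_gt0 ltr_expR; lra.
Qed.

Lemma coshRN (R : realType) (t : R) : coshR (- t) = coshR t.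
Proof. by rewrite /coshR opprK addrC. Qed.

#[global] Instance is_derive_sinhR (R : realType) (t : R) :
  is_derive t 1 (@sinhR R) (coshR t).
Proof.
rewrite /sinhR /coshR.
apply: is_derive_eq.
by rewrite /GRing.scale /=; lra.
Qed.

#[global] Instance is_derive_coshR (R : realType) (t : R) :
  is_derive t 1 (@coshR R) (sinhR t).
Proof.
rewrite /sinhR /coshR.
apply: is_derive_eq.
by rewrite /GRing.scale /=; lra.
Qed.

Lemma continuous_sinhR (R : realType) : continuous (@sinhR R).
Proof.
move=> t; apply/differentiable_continuous/derivable1_diffP.
by case: (is_derive_sinhR t).
Qed.

Lemma measurable_coshR (R : realType) : measurable_fun setT (@coshR R).
Proof.
apply: continuous_measurable_fun => t.
apply/differentiable_continuous/derivable1_diffP.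
by case: (is_derive_coshR t).
Qed.

Lemma sinhR_lt (R : realType) (x y : R) : x < y -> sinhR x < sinhR y.
Proof.
move=> xy; rewrite /sinhR ltr_pM2r// ltr_leB ?ltr_expR// ler_expR lerN2.
exact: ltW.
Qed.

Lemma sinhR_ge (R : realType) (t : R) : 0 < t -> t <= sinhR t.
Proof.
move=> t0.
have cs : {within `[0, t], continuous (@sinhR R)}.
  apply: continuous_subspaceT => z.
  by apply/differentiable_continuous/derivable1_diffP; case: (is_derive_sinhR z).
have [u _] := MVT t0 (fun z _ => is_derive_sinhR z) cs.
have -> : sinhR (0 : R) = 0 by rewrite /sinhR oppr0 subrr mul0r.
rewrite !subr0 => ->.
rewrite ler_peMl ?(ltW t0)// /coshR.
have uN : expR u * expR (- u) = 1 by rewrite -expRD subrr expR0.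
have := mulr_ge0 (expR_ge0 (- u)) (sqr_ge0 (expR u - 1)).
have -> : expR (- u) * (expR u - 1) ^+ 2 = (expR u * expR (- u)) * expR u
  - 2 * (expR u * expR (- u)) + expR (- u) by ring.
by rewrite uN; lra.
Qed.

Lemma coshR_lt (R : realType) (x y : R) : 0 < x -> x < y -> coshR x < coshR y.
Proof.
move=> x0 xy.
have ex : 1 < expR x by rewrite expR_gt1.
have exy : expR x < expR y by rewrite ltr_expR.
rewrite /coshR ltr_pM2r// !expRN.
set p := expR x in ex exy *; set q := expR y in exy *.
have pq : 1 < p * q by nra.
have -> : q + q^-1 = p + p^-1 + (q - p) * (p * q - 1) / (p * q).
  by field; apply/andP; split; apply/eqP; lra.
rewrite ltrDl divr_gt0// ?mulr_gt0//; lra.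
Qed.

(** The square of the tangent bound 1 + t / 2 <= expR (t / 2). *)
Lemma expR_ge_quadratic (R : realType) (t : R) :
  0 <= t -> 1 + t + t ^+ 2 / 4 <= expR t.
Proof.
move=> t0; have := expR_ge1Dx (t / 2).
have -> : expR t = expR (t / 2) * expR (t / 2) by rewrite -expRD -splitr.
set u := expR _ => tu; nra.
Qed.

(** The difference h of the two sides has a strictly decreasing derivative and
    vanishes at 0, so h t / t is strictly decreasing; a zero t0 > 0 of h, found
    by the intermediate value theorem, is then its only sign change. *)
Lemma sinh_sign_change (R : realType) (c : R) : 0 < c ->
  exists2 t0, 0 < t0 & forall t : R, 0 < t ->
    (t < t0 -> c * sinhR t < (c + 1) * t) /\
    (t0 < t -> (c + 1) * t < c * sinhR t).
Proof.
move=> c0.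
pose h t := (c + 1) * t - c * sinhR t.
have h0 : h 0 = 0 by rewrite /h /sinhR oppr0 subrr mul0r !mulr0 subr0.
have dh (z : R) : is_derive z 1 h (c + 1 - c * coshR z).
  rewrite /h; apply: is_derive_eq.
  by rewrite /GRing.scale /=; lra.
have h_decr x y : 0 < x -> x < y -> h y * x < h x * y.
  apply: (ratio_decreasing h0 dh) => u v u0 uv.
  by have := coshR_lt u0 uv; nra.
(* The endpoint e is where sinhR t <= t * expR t yields 0 <= h t. *)
pose e := ln (1 + c^-1).
have ci0 : 0 < c^-1 by rewrite invr_gt0.
have e0 : 0 < e by rewrite ln_gt0//; lra.
have he : 0 <= h e.
  have eE : expR e = 1 + c^-1 by rewrite lnK// posrE; lra.
  have sh : sinhR e <= e * (1 + c^-1).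
    have := expR_ge1Dx (- e - e); rewrite expRD /sinhR.
    have ee : expR e * expR (- e) = 1 by rewrite -expRD subrr expR0.
    have := expR_gt0 (- e); have := expR_gt0 e; rewrite eE in ee *.
    set u := expR (- e) in ee *; nra.
  have cc : c * c^-1 = 1 by rewrite mulfV// gt_eqF.
  rewrite /h; nra.
(* The endpoint M is where the quadratic bound on expR t yields h t <= 0. *)
pose M := 8 * (1 + c^-1).
have hM : h M <= 0.
  have M0 : 0 < M by rewrite /M; lra.
  have := expR_ge_quadratic (ltW M0).
  have : expR (- M) <= 1 by rewrite expR_le1; lra.
  have cc : c * c^-1 = 1 by rewrite mulfV// gt_eqF.
  rewrite /h /sinhR.
  have -> : (c + 1) * M = c * (M * M) / 8.
    have -> : c + 1 = c * (1 + c^-1) by rewrite mulrDr cc mulr1.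
    by rewrite /M; set k := 1 + _; field.
  have := expR_gt0 (- M); nra.
have eM : e <= M.
  have c1 : 0 < 1 + c^-1 by lra.
  have : ln (1 + c^-1) <= ln (expR c^-1).
    by rewrite ler_ln ?posrE ?expR_gt0// expR_ge1Dx.
  by rewrite expRK -/e /M; lra.
have ch : {within `[e, M], continuous h}.
  apply: continuous_subspaceT => z.
  by apply/differentiable_continuous/derivable1_diffP; case: (dh z).
have [|t0 + ht0] := IVT eM ch (v := 0).
  by rewrite ge_min le_max he hM orbT.
rewrite in_itv/= => /andP[et _].
have t00 : 0 < t0 by exact: lt_le_trans et.
exists t0 => // t tp; split => [tt0|t0t].
  by have := h_decr _ _ tp tt0; rewrite ht0 mul0r pmulr_lgt0// /h; lra.
by have := h_decr _ _ t00 t0t; rewrite ht0 mul0r pmulr_llt0// /h; lra.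
Qed.

(** A quadratic lower bound for the exponential turns an arbitrary linear term
    into exponential decay, whatever the sign of mu. *)
Lemma linear_minus_expR_le (R : realType) (mu b : R) : 0 < b ->
  exists C, forall t : R, 0 <= t -> mu * t - b * expR t <= C - t.
Proof.
(* The constant comes from completing the square in
   (`|mu| + 1) * t - b * t ^+ 2 / 4. *)
move=> b0; exists ((`|mu| + 1) ^+ 2 / b) => t t0.
have := expR_ge_quadratic t0; have := ler_norm mu.
set n := `|mu| => mun e4.
have n0 : 0 <= n by exact: normr_ge0.
have bC : b * ((n + 1) ^+ 2 / b) = (n + 1) ^+ 2 by field; rewrite gt_eqF.
have C0 : 0 <= (n + 1) ^+ 2 / b by rewrite divr_ge0 ?sqr_ge0// ltW.
set C := _ / b in bC C0 *.
have H1 : mu * t <= n * t by rewrite ler_wpM2r.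
have H2 : b * (1 + t + t ^+ 2 / 4) <= b * expR t by rewrite ler_wpM2l// ltW.
have H3 : (n + 1) * t <= C + b * (t ^+ 2 / 4).
  rewrite -(ler_pM2l b0) mulrDr bC.
  have := sqr_ge0 ((n + 1) - b * t / 2); nra.
nra.
Qed.

Lemma expR_cvg0 (R : realType) (f : R -> R) (C kappa : R) : 0 < kappa ->
  (forall t, 0 <= t -> f t <= C - kappa * t) ->
  expR (f t) @[t --> +oo] --> (0 : R).
Proof.
move=> k0 fC.
have H : expR C * expR (- (kappa * t)) @[t --> +oo] --> (0 : R).
  rewrite -(mulr0 (expR C)); apply: cvgMl_tmp.
  have -> : (fun t => expR (- (kappa * t))) =
    (fun t => expR (- t)) \o (fun t => kappa * t) by [].
  apply: (cvg_comp _ _ _ (@cvgr_expR R)).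
  by apply: gt0_cvgMry.
apply: (squeeze_cvgr _ (@cvg_cst _ _ _ _ _) H).
near=> t; rewrite expR_ge0/= -expRD ler_expR; apply: fC.
by near: t; apply: nbhs_pinfty_ge; rewrite num_real.
Unshelve. all: by end_near. Qed.


(** * The generalized inverse Gaussian weight *)

(** The density, up to a constant factor, of t when w * expR t follows the
    generalized inverse Gaussian law; a and b absorb the scale w. *)
Definition gig_weight (R : realType) (lambda a b t : R) : R :=
  expR (lambda * t - a * expR (- t) - b * expR t).

Lemma gig_weight_gt0 (R : realType) (lambda a b t : R) :
  0 < gig_weight lambda a b t.
Proof. exact: expR_gt0. Qed.

Lemma gig_weight_ltN (R : realType) (lambda a b t : R) :
  (gig_weight lambda a b (- t) < gig_weight lambda a b t) =
  ((b - a) * sinhR t < lambda * t).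
Proof.
rewrite ltr_expR -subr_gt0 -[RHS]subr_gt0 /sinhR opprK.
rewrite -(pmulr_rgt0 (lambda * t - _) (ltr0n R 2)).
by congr (0 < _); field.
Qed.

Lemma gig_weight_gtN (R : realType) (lambda a b t : R) :
  (gig_weight lambda a b t < gig_weight lambda a b (- t)) =
  (lambda * t < (b - a) * sinhR t).
Proof.
by rewrite -{1}[t]opprK gig_weight_ltN sinhRN !mulrN ltrN2.
Qed.

Lemma continuous_gig_weight (R : realType) (lambda a b : R) :
  continuous (gig_weight lambda a b).
Proof.
move=> t; apply/differentiable_continuous/derivable1_diffP.
by rewrite /gig_weight; apply: ex_derive.
Qed.

(** The left-hand side is at most kappa * (a + b) * sinhR (t / 2) times q t - q
    (- t). If this difference changes sign at t0, then kappa is chosen so that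
    kappa * (a + b) * sinhR (t / 2) and G (k * sinhR (t / 2)) agree at t0.
    Since G y / y decreases, the latter is the larger one before t0, where the
    difference is positive, and the smaller one after t0, where the difference
    is negative. If the difference is always positive, kappa is 0. *)
Lemma gig_weight_pairing (R : realType) (lambda a b k : R) (G : R -> R) :
  0 <= a -> 0 < b -> b - a = lambda - 1 / 2 -> 0 < k ->
  (forall y : R, 0 < y -> 0 < G y) ->
  (forall x y : R, 0 < x -> x < y -> G y * x < G x * y) ->
  let q := gig_weight lambda a b in
  exists kappa t0 : R, 0 <= kappa /\ forall t : R, 0 < t -> t != t0 ->
    kappa * (sinhR (t / 2) * ((b + a * expR (- t)) * q t
                             - (b + a * expR t) * q (- t))) <
    G (k * sinhR (t / 2)) * (q t - q (- t)).
Proof.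
move=> a0 b0 ab k0 G0 Gdecr q.
have q0 t : 0 < q t by exact: gig_weight_gt0.
have sh0 (t : R) : 0 < t -> 0 < sinhR (t / 2) by move=> t0; apply: sinhR_gt0; lra.
have G0' (t : R) : 0 < t -> 0 < G (k * sinhR (t / 2)).
  by move=> t0; rewrite G0// mulr_gt0// sh0.
have lE : lambda = b - a + 1 / 2 by lra.
have [ba|ba] := leP b a.
  exists 0, 0; split=> // t t0 _; rewrite mul0r mulr_gt0 ?G0'//.
  rewrite subr_gt0 gig_weight_ltN.
  by have := sinhR_ge t0; rewrite lE; nra.
have c0 : 0 < 2 * (b - a) by lra.
have [t0 t00 sgn] := sinh_sign_change c0.
exists (G (k * sinhR (t0 / 2)) / (sinhR (t0 / 2) * (a + b))), t0.
have s00 := sh0 _ t00; have G00 := G0' _ t00.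
have aB : 0 < a + b by lra.
have gs := divr_gt0 G00 s00.
split; first by rewrite divr_ge0// ltW// mulr_gt0.
move=> t tp tt0; have [sgn1 sgn2] := sgn t tp.
have st := sh0 _ tp; have Gt := G0' _ tp.
apply: (@le_lt_trans _ _ (G (k * sinhR (t0 / 2)) / sinhR (t0 / 2) *
  (sinhR (t / 2) * (q t - q (- t))))).
  set X := _ * q t - _.
  have -> : G (k * sinhR (t0 / 2)) / (sinhR (t0 / 2) * (a + b)) *
      (sinhR (t / 2) * X) =
    G (k * sinhR (t0 / 2)) / sinhR (t0 / 2) * (sinhR (t / 2) * (X / (a + b))).
    by field; rewrite !gt_eqF.
  rewrite (ler_pM2l gs) (ler_pM2l st) ler_pdivrMr// /X.
  have e1 : expR (- t) <= 1 by rewrite expR_le1; lra.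
  have e2 : 1 <= expR t by rewrite -expR0 ler_expR; lra.
  have := mulr_ge0 (mulr_ge0 a0 (ltW (q0 t))) (_ : 0 <= 1 - expR (- t)).
  have := mulr_ge0 (mulr_ge0 a0 (ltW (q0 (- t)))) (_ : 0 <= expR t - 1).
  by rewrite !subr_ge0 => /(_ e2) ? /(_ e1) ?; lra.
rewrite mulrA.
move: tt0; rewrite neq_lt => /orP[tt0|t0t].
  rewrite ltr_pM2r; last first.
    by rewrite subr_gt0 gig_weight_ltN; have := sgn1 tt0; rewrite lE; lra.
  have s1 : sinhR (t / 2) < sinhR (t0 / 2) by apply: sinhR_lt; lra.
  rewrite mulrAC ltr_pdivrMr//.
  have := Gdecr (k * sinhR (t / 2)) (k * sinhR (t0 / 2)).
  rewrite mulr_gt0// ltr_pM2l// => /(_ isT s1).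
  by rewrite !mulrA ![_ * k]mulrC -!mulrA ltr_pM2l.
rewrite ltr_nM2r; last first.
  by rewrite subr_lt0 gig_weight_gtN; have := sgn2 t0t; rewrite lE; lra.
have s1 : sinhR (t0 / 2) < sinhR (t / 2) by apply: sinhR_lt; lra.
rewrite mulrAC ltr_pdivlMr//.
have := Gdecr (k * sinhR (t0 / 2)) (k * sinhR (t / 2)).
rewrite mulr_gt0// ltr_pM2l// => /(_ isT s1).
by rewrite !mulrA ![_ * k]mulrC -!mulrA ltr_pM2l.
Qed.


(** * Lebesgue integrals of nonnegative functions *)

Lemma measurable_EFin_comp (R : realType) (D : set R) (f : R -> R) :
  measurable_fun setT f -> measurable_fun D (fun x => (f x)%:E).
Proof. by move=> mf; apply: measurable_funTS; exact/measurable_EFinP. Qed.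

Section change_of_variables.
Context {R : realType}.
Local Notation mu := (@lebesgue_measure R).
Local Open Scope ereal_scope.

Lemma lebesgue_measure_affine (a b : R) (A : set R) : (0 < a)%R ->
  measurable A ->
  mu A = a%:E * mu ((fun x => a * x + b)%R @^-1` A).
Proof.
move=> a0 mA.
have mphi : measurable_fun [set: measurableTypeR R]
  (fun x : R => a * x + b : measurableTypeR R)%R.
  by apply: measurable_funD => //; exact: measurable_funM.
pose phi : measurableTypeR R -> measurableTypeR R := (fun x => a * x + b)%R.
pose k : {nonneg R} := NngNum (ltW a0).
pose nu : {measure set (measurableTypeR R) -> \bar R} :=
  mscale k (pushforward mu phi).
suff : mu A = nu mphi A by [].
apply: lebesgue_measure_unique => //= _ [[c d]] _ <-.
rewrite /mscale/= /pushforward/=.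
have -> : phi @^-1` `]c, d]%classic = `]((c - b) / a)%R, ((d - b) / a)%R]%classic.
  apply/seteqP; split => x; rewrite /= !in_itv/= /phi.
    by rewrite ltr_pdivrMr// ler_pdivlMr// ltrBlDr lerBrDr mulrC.
  by rewrite ltr_pdivrMr// ler_pdivlMr// ltrBlDr lerBrDr mulrC.
rewrite !lebesgue_measure_itv/= !lte_fin ltr_pM2r ?invr_gt0// ltrD2r.
case: ifP => _; rewrite ?mule0// -!EFinD -EFinM; congr EFin.
by field; rewrite gt_eqF.
Qed.

Lemma ge0_integral_affine (a b : R) (D : set R) (f : R -> \bar R) : (0 < a)%R ->
  measurable D -> measurable_fun D f -> (forall x, 0 <= f x) ->
  \int[mu]_(x in D) f x =
  a%:E * \int[mu]_(x in (fun x => a * x + b)%R @^-1` D) f (a * x + b)%R.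
Proof.
move=> a0 mD mf f0.
have mphi : measurable_fun [set: measurableTypeR R]
  (fun x : R => a * x + b : measurableTypeR R)%R.
  by apply: measurable_funD => //; exact: measurable_funM.
pose phi : measurableTypeR R -> measurableTypeR R := (fun x => a * x + b)%R.
pose k : {nonneg R} := NngNum (ltW a0).
rewrite -[X in _ = _ * X](@ge0_integral_pushforward _ _ _ _ _ phi mphi mu D f)//.
rewrite -[a]/(k%:num)%R -ge0_integral_mscale//.
by apply: eq_measure_integral => //= A mA _; rewrite (lebesgue_measure_affine b a0).
Qed.

Lemma ge0_integral_oppr (D : set R) (f : R -> \bar R) :
  measurable D -> measurable_fun D f -> (forall x, 0 <= f x) ->
  \int[mu]_(x in D) f x = \int[mu]_(x in (-%R : R -> R) @^-1` D) f (- x)%R.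
Proof.
move=> mD mf f0.
rewrite -[RHS](@ge0_integral_pushforward _ _ (measurableTypeR R) (measurableTypeR R)
  _ (-%R : R -> measurableTypeR R) _ mu D f)//.
by apply: eq_measure_integral => //= A mA _; rewrite lebesgue_measureN.
Qed.

Lemma ge0_integral_fold (f : R -> \bar R) :
  measurable_fun setT f -> (forall x, 0 <= f x) ->
  \int[mu]_x f x = \int[mu]_(x in `[0%R, +oo[) (f x + f (- x)%R).
Proof.
move=> mf f0.
have mfN : measurable_fun setT (fun x : R => f (- x)%R).
  exact: measurableT_comp.
rewrite ge0_integralD//=; last 2 first.
- exact: measurable_funTS.
- exact: measurable_funTS.
rewrite (ge0_integration_by_substitution0 mfN)//.
under [X in _ + X]eq_integral do rewrite opprK.
rewrite -(integral_itv_obnd_cbnd (r := 0%R)); last exact: measurable_funTS.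
rewrite -{1}(setvU `]-oo, 0%R]%classic) ge0_integral_setU//=.
- by rewrite setCitvl.
- exact: measurableC.
- by rewrite setvU.
- by rewrite disj_set2E setICl.
Qed.

End change_of_variables.

(** If the integrals were equal, the positive function g - f would have
    integral zero and so vanish almost everywhere on a set of nonzero
    measure. *)
Lemma ge0_integral_lt d (T : measurableType d) (R : realType)
    (mu : {measure set T -> \bar R}) (D : set T) (f g : T -> R) :
  measurable D -> mu D != 0%E ->
  measurable_fun D f -> measurable_fun D g ->
  (forall x, D x -> 0 <= f x) -> (forall x, D x -> f x < g x) ->
  (\int[mu]_(x in D) (f x)%:E < +oo)%E ->
  (\int[mu]_(x in D) (f x)%:E < \int[mu]_(x in D) (g x)%:E)%E.
Proof.
move=> mD muD mf mg f0 fg foo.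
have g0 x : D x -> 0 <= g x by move=> Dx; rewrite (le_trans (f0 x Dx))// ltW// fg.
have [goo|] := ltP (\int[mu]_(x in D) (g x)%:E)%E +oo%E; last exact: lt_le_trans.
have If : mu.-integrable D (EFin \o f).
  apply/integrableP; split; first exact/measurable_EFinP.
  by under eq_integral => x /[!inE] Dx do rewrite /= ger0_norm ?f0//.
have Ig : mu.-integrable D (EFin \o g).
  apply/integrableP; split; first exact/measurable_EFinP.
  by under eq_integral => x /[!inE] Dx do rewrite /= ger0_norm ?g0//.
rewrite lt_neqAle; apply/andP; split; last first.
  apply: ge0_le_integral => //.
  - exact/measurable_EFinP.
  - exact/measurable_EFinP.
  - by move=> x Dx; rewrite lee_fin ltW// fg.
apply/negP => /eqP fgE.
have : (\int[mu]_(x in D) `|(g x - f x)%:E| = 0)%E.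
  under eq_integral => x /[!inE] Dx.
    rewrite abse_EFin ger0_norm; last by rewrite subr_ge0 ltW// fg.
    rewrite EFinB; over.
  rewrite integralB//= fgE subee//.
  exact: integrable_fin_num.
move/ae_eq_integral_abs => /(_ mD); case.
  by apply/measurable_EFinP; exact: measurable_funB.
move=> N [mN N0 DN]; apply/negP : muD; rewrite negbK.
apply/eqP/(subset_measure0 mD mN _ N0) => x Dx; apply: DN => /= /(_ Dx) [].
by apply/eqP; rewrite subr_eq0 gt_eqF// fg.
Qed.

Lemma ge0_integral_exchange d1 d2 (T1 : measurableType d1) (T2 : measurableType d2)
    (R : realType) (m1 : {sigma_finite_measure set T1 -> \bar R})
    (m2 : {sigma_finite_measure set T2 -> \bar R}) (A : set T1) (k : T1 * T2 -> R) :
  measurable A -> measurable_fun setT k -> (forall z, 0 <= k z) ->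
  (\int[m1]_(x in A) \int[m2]_t (k (x, t))%:E =
   \int[m2]_t \int[m1]_(x in A) (k (x, t))%:E)%E.
Proof.
move=> mA mk k0.
pose f (z : T1 * T2) := (k z * \1_A z.1)%:E.
have mf : measurable_fun setT f.
  apply/measurable_EFinP; apply: measurable_funM => //.
  exact: measurableT_comp.
have f0 z : (0 <= f z)%E by rewrite lee_fin mulr_ge0.
have := @fubini_tonelli _ _ T1 T2 R m1 m2 f mf f0.
rewrite /f /= => fub.
rewrite integral_mkcond; transitivity (\int[m1]_x \int[m2]_t (k (x, t) * \1_A x)%:E)%E.
  apply: eq_integral => x _; rewrite patchE; case: ifPn => xA.
    by apply: eq_integral => t _; rewrite indicE xA mulr1.
  by rewrite integral0_eq// => t _; rewrite indicE (negbTE xA) mulr0.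
rewrite fub; apply: eq_integral => t _.
rewrite [RHS]integral_mkcond; apply: eq_integral => x _.
by rewrite patchE indicE; case: ifPn => xA; rewrite ?mulr1 ?mulr0.
Qed.


(** * The standard normal distribution function *)

Definition std_cdf (R : realType) (u : R) : R :=
  fine (normal_prob (0 : R) 1 `]-oo, u]).

Lemma std_cdfE (R : realType) (u : R) :
  (std_cdf u)%:E = normal_prob (0 : R) 1 `]-oo, u].
Proof. by rewrite fineK// fin_num_measure. Qed.

Lemma std_cdf_ge0 (R : realType) (u : R) : 0 <= std_cdf u.
Proof. exact: fine_ge0. Qed.

Lemma std_pdfE (R : realType) (x : R) :
  normal_pdf 0 1 x = normal_peak 1 * expR (- (x ^+ 2 / 2)).
Proof.
by rewrite normal_pdfE ?oner_eq0// /normal_fun subr0 expr1n mulNr.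
Qed.

#[global] Instance is_derive_std_cdf (R : realType) (u : R) :
  is_derive u 1 (@std_cdf R) (normal_pdf 0 1 u).
Proof.
have [] := @continuous_FTC1 R (normal_pdf 0 1) -oo%O u (u + 1) _
  (integrableS measurableT _ (@subsetT _ _) (integrable_normal_pdf 0 1)) _ _.
- by rewrite ltrDl.
- by [].
- by rewrite ltNyr.
- exact: continuous_normal_pdf.
by move=> dP P'E; apply: DeriveDef => //; rewrite -derive1E.
Qed.

Lemma continuous_std_cdf (R : realType) : continuous (@std_cdf R).
Proof.
move=> t; apply/differentiable_continuous/derivable1_diffP.
by case: (is_derive_std_cdf t).
Qed.

Lemma measurable_EFin_normal_pdf (R : realType) (D : set R) :
  measurable_fun D (fun x : R => (normal_pdf 0 1 x)%:E).
Proof.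
apply: measurable_funTS; apply/measurable_EFinP.
exact: measurable_normal_pdf.
Qed.

Lemma normal_prob_tail (R : realType) (u : R) :
  normal_prob (0 : R) 1 `]u, +oo[ = (std_cdf (- u))%:E.
Proof.
rewrite std_cdfE /normal_prob ge0_integral_oppr//; last 2 first.
- exact: measurable_EFin_normal_pdf.
- by move=> x; rewrite lee_fin normal_pdf_ge0.
rewrite opp_preimage_itvbndy -integral_itv_bndo_bndc; last first.
  exact: measurable_EFin_normal_pdf.
by apply: eq_integral => x _; rewrite !std_pdfE sqrrN.
Qed.

Lemma std_cdf_centered_gt0 (R : realType) (y : R) : 0 < y ->
  0 < std_cdf y - std_cdf (- y).
Proof.
move=> y0.
have yy : - y < y by lra.
have cP : {within `[- y, y], continuous (@std_cdf R)}.
  apply: continuous_subspaceT => z.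
  by apply/differentiable_continuous/derivable1_diffP; case: (is_derive_std_cdf z).
have [u _ ->] := MVT yy (fun z _ => is_derive_std_cdf z) cP.
by rewrite mulr_gt0//; [rewrite std_pdfE mulr_gt0 ?expR_gt0// normal_peak_gt0|lra].
Qed.

(** The derivative of y |-> std_cdf y - std_cdf (- y) is twice the normal
    density, which decreases on the positive half-line. *)
Lemma std_cdf_centered_ratio (R : realType) (x y : R) : 0 < x -> x < y ->
  (std_cdf y - std_cdf (- y)) * x < (std_cdf x - std_cdf (- x)) * y.
Proof.
apply: (@ratio_decreasing _ (fun x => std_cdf x - std_cdf (- x))
  (fun x => 2 * normal_pdf 0 1 x)).
- by rewrite oppr0 subrr.
- move=> z; apply: is_derive_eq.
  by rewrite /GRing.scale /= !std_pdfE sqrrN; ring.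
- move=> u v u0 uv; rewrite ltr_pM2l// !std_pdfE ltr_pM2l ?normal_peak_gt0//.
  by rewrite ltr_expR ltrN2 ltr_pM2r// ltr_pXn2r// nnegrE ltW// (lt_trans u0).
Qed.


(** * The comparison of the two tails *)

(** Up to sign the integrand is the derivative of the weight of index b - a.
    Thanks to that index its linear coefficient regroups as b * (expR t - 1) +
    a * (1 - expR (- t)), which is nonnegative on the half-line, so that the
    fundamental theorem of calculus applies without an integrability
    condition. *)
Lemma gig_weight_telescope (R : realType) (a b : R) :
  0 <= a -> 0 <= b -> 0 < a + b ->
  (\int[lebesgue_measure]_(t in `[0%R, +oo[)
    ((b * (expR t - 1) + a * (1 - expR (- t))) * gig_weight (b - a) a b t)%:E
  = (expR (- (a + b)))%:E)%E.
Proof.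
move=> a0 b0 ab.
pose F (t : R) := - gig_weight (b - a) a b t.
pose f t := (b * (expR t - 1) + a * (1 - expR (- t))) * gig_weight (b - a) a b t.
have dF (t : R) : is_derive t 1 F (f t).
  rewrite /F /f /gig_weight; apply: is_derive_eq.
  by rewrite /GRing.scale /=; ring.
have cF : continuous F.
  move=> z; apply/differentiable_continuous/derivable1_diffP.
  by case: (dF z).
have cf : continuous f.
  move=> z; apply/differentiable_continuous/derivable1_diffP.
  by rewrite /f /gig_weight; apply: ex_derive.
have -> : expR (- (a + b)) = 0 - F 0.
  by rewrite /F sub0r opprK /gig_weight oppr0 expR0; congr expR; ring.
rewrite EFinB; apply: ge0_continuous_FTC2y.
- move=> t t0; rewrite mulr_ge0 ?expR_ge0// addr_ge0// mulr_ge0// subr_ge0.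
    by rewrite -expR0 ler_expR.
  by rewrite expR_le1; lra.
- exact: continuous_subspaceT.
- rewrite -oppr0; apply: cvgN.
  have [b00|b00] := eqVneq b 0.
    apply: (@expR_cvg0 _ _ 0 a); first by lra.
    by move=> t t0; rewrite b00; have := mulr_ge0 a0 (expR_ge0 (- t)); lra.
  have bp : 0 < b by rewrite lt_neqAle eq_sym b00.
  have [C HC] := linear_minus_expR_le (b - a) bp.
  apply: (@expR_cvg0 _ _ C 1) => // t t0.
  by have := mulr_ge0 a0 (expR_ge0 (- t)); have := HC _ t0; lra.
- by move=> t _; case: (dF t).
- exact/cvg_at_right_filter/cF.
- by move=> t _; rewrite derive1E derive_val.
Qed.

(** Both integrands are half of one in [gig_weight_telescope], the second with
    a and b exchanged: a factor expR (t / 2), respectively expR (- (t / 2)),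
    splits off from q and turns 2 * sinhR (t / 2) into expR t - 1, respectively
    1 - expR (- t). What matters below is that the two values coincide. *)
Lemma gig_weight_moment (R : realType) (lambda a b : R) :
  0 <= a -> 0 < b -> b - a = lambda - 1 / 2 ->
  let q := gig_weight lambda a b in
  (\int[lebesgue_measure]_(t in `[0%R, +oo[)
    (sinhR (t / 2) * ((b + a * expR (- t)) * q t))%:E =
    (expR (- (a + b)) / 2)%:E)%E /\
  (\int[lebesgue_measure]_(t in `[0%R, +oo[)
    (sinhR (t / 2) * ((b + a * expR t) * q (- t)))%:E =
    (expR (- (a + b)) / 2)%:E)%E.
Proof.
move=> a0 b0 ab q.
have half (F G : R -> R) (c : R) : (forall t, 0 <= t -> 0 <= G t) ->
    continuous G -> (forall t, F t = 2^-1 * G t) ->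
    (\int[lebesgue_measure]_(t in `[0%R, +oo[) (G t)%:E = c%:E)%E ->
    (\int[lebesgue_measure]_(t in `[0%R, +oo[) (F t)%:E = (c / 2)%:E)%E.
  move=> G0 cG FG IG.
  under eq_integral do rewrite FG EFinM.
  rewrite ge0_integralZl//=.
  - by rewrite IG -EFinM mulrC.
  - by apply: measurable_EFin_comp; exact: continuous_measurable_fun.
  - by move=> t; rewrite in_itv/= andbT lee_fin => /G0.
have G0 (c d : R) : 0 <= c -> 0 <= d -> forall t, 0 <= t ->
    0 <= (d * (expR t - 1) + c * (1 - expR (- t))) * gig_weight (d - c) c d t.
  move=> c0 d0 t t0; rewrite mulr_ge0 ?expR_ge0// addr_ge0// mulr_ge0// subr_ge0.
    by rewrite -expR0 ler_expR.
  by rewrite expR_le1; lra.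
have cG (c d : R) : continuous (fun t =>
    (d * (expR t - 1) + c * (1 - expR (- t))) * gig_weight (d - c) c d t).
  move=> t; apply/differentiable_continuous/derivable1_diffP.
  by rewrite /gig_weight; apply: ex_derive.
have e2 (t : R) : expR t = expR (t / 2) * expR (t / 2) by rewrite -expRD -splitr.
have eN (t : R) : expR t * expR (- t) = 1 by rewrite -expRD subrr expR0.
have lE : lambda = b - a + 1 / 2 by lra.
split.
- apply: (half _ _ _ (G0 a b a0 (ltW b0)) (cG a b)); last first.
    by apply: gig_weight_telescope; lra.
  move=> t.
  have -> : q t = expR (t / 2) * gig_weight (b - a) a b t.
    by rewrite /q /gig_weight -expRD; congr expR; rewrite lE; lra.
  have := eN (t / 2); have := eN t; rewrite /sinhR (e2 t) -mulNr (e2 (- t)).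
  rewrite mulNr; set p := expR (t / 2); set p' := expR (- _) => _ pp.
  rewrite [2^-1 * _]mulrA [RHS]mulrC [X in X = _](_ : _ = gig_weight (b - a) a b t *
    ((p * p - p * p') / 2 * (b + a * (p' * p')))); last by ring.
  congr (_ * _); rewrite pp.
  have -> : (p * p - 1) / 2 * (b + a * (p' * p')) = 
    2^-1 * (b * (p * p - 1) + a * ((p * p') * (p * p') - p' * p')) by field.
  by rewrite pp mulr1.
- rewrite [a + b]addrC.
  apply: (half _ _ _ (G0 b a (ltW b0) a0) (cG b a)); last first.
    by apply: gig_weight_telescope; lra.
  move=> t.
  have -> : q (- t) = expR (- (t / 2)) * gig_weight (a - b) b a t.
    by rewrite /q /gig_weight -expRD opprK; congr expR; rewrite lE; lra.
  have := eN (t / 2); have := eN t; rewrite /sinhR (e2 t) -mulNr (e2 (- t)).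
  rewrite mulNr; set p := expR (t / 2); set p' := expR (- _) => _ pp.
  rewrite [2^-1 * _]mulrA [RHS]mulrC [X in X = _](_ : _ = gig_weight (a - b) b a t *
    ((p * p' - p' * p') / 2 * (b + a * (p * p)))); last by ring.
  congr (_ * _); rewrite pp.
  have -> : (1 - p' * p') / 2 * (b + a * (p * p)) = 
    2^-1 * (a * (p * p - (p * p') * (p * p')) + b * (1 - p' * p')) by field.
  by rewrite pp mulr1.
Qed.

(** Folding at 0 gives integrals over t >= 0.  The equal numbers provided by
    [gig_weight_moment], times kappa, are added crosswise to the two sides: all
    integrands stay nonnegative and [gig_weight_pairing] compares them
    pointwise. *)
Lemma gig_normal_lt (R : realType) (lambda a b k : R) :
  0 <= a -> 0 < b -> b - a = lambda - 1 / 2 -> 0 < k ->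
  let q := gig_weight lambda a b in
  let v t := k * sinhR (t / 2) in
  (\int[lebesgue_measure]_t (q t * std_cdf (- v t))%:E < +oo)%E ->
  (\int[lebesgue_measure]_t (q t * std_cdf (- v t))%:E <
   \int[lebesgue_measure]_t (q t * std_cdf (v t))%:E)%E.
Proof.
move=> a0 b0 ab k0 q v.
have cq : continuous q by exact: continuous_gig_weight.
have q0 t : 0 < q t by exact: gig_weight_gt0.
have vN t : v (- t) = - v t by rewrite /v mulNr sinhRN mulrN.
have mq : measurable_fun setT q by exact: continuous_measurable_fun.
have mv : measurable_fun setT v.
  apply: measurable_funM => //; apply: measurableT_comp.
    by apply: continuous_measurable_fun; exact: continuous_sinhR.
  exact: measurable_funM.
have mP : measurable_fun setT (@std_cdf R).
  by apply: continuous_measurable_fun; exact: continuous_std_cdf.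
have mqN : measurable_fun setT (fun t : R => q (- t)) by exact: measurableT_comp.
have mPv : measurable_fun setT (fun t : R => std_cdf (v t)).
  exact: measurableT_comp.
have mPNv : measurable_fun setT (fun t : R => std_cdf (- v t)).
  by apply: measurableT_comp => //; exact: measurableT_comp.
pose I1 t := q t * std_cdf (- v t) + q (- t) * std_cdf (v t).
pose I2 t := q t * std_cdf (v t) + q (- t) * std_cdf (- v t).
have -> : (\int[lebesgue_measure]_t (q t * std_cdf (- v t))%:E =
    \int[lebesgue_measure]_(t in `[0%R, +oo[) (I1 t)%:E)%E.
  rewrite ge0_integral_fold.
  - by apply: eq_integral => t _; rewrite vN opprK -EFinD.
  - by apply/measurable_EFinP; exact: measurable_funM.
  - by move=> t; rewrite lee_fin mulr_ge0 ?std_cdf_ge0// ltW.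
have -> : (\int[lebesgue_measure]_t (q t * std_cdf (v t))%:E =
    \int[lebesgue_measure]_(t in `[0%R, +oo[) (I2 t)%:E)%E.
  rewrite ge0_integral_fold.
  - by apply: eq_integral => t _; rewrite vN -EFinD.
  - by apply/measurable_EFinP; exact: measurable_funM.
  - by move=> t; rewrite lee_fin mulr_ge0 ?std_cdf_ge0// ltW.
have mI1 : measurable_fun setT I1.
  by apply: measurable_funD; exact: measurable_funM.
have mI2 : measurable_fun setT I2.
  by apply: measurable_funD; exact: measurable_funM.
have I10 t : 0 <= I1 t by rewrite addr_ge0// mulr_ge0 ?std_cdf_ge0// ltW.
have I20 t : 0 <= I2 t by rewrite addr_ge0// mulr_ge0 ?std_cdf_ge0// ltW.
move=> I1oo.
have [kappa [t0 [kappa0 lt]]] := gig_weight_pairing a0 b0 ab k0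
  (@std_cdf_centered_gt0 R) (@std_cdf_centered_ratio R).
rewrite -/q in lt.
have [J1E J2E] := gig_weight_moment a0 b0 ab.
rewrite -/q in J1E J2E.
set J1 := (fun t => sinhR (t / 2) * ((b + a * expR (- t)) * q t)) in J1E.
set J2 := (fun t => sinhR (t / 2) * ((b + a * expR t) * q (- t))) in J2E.
have mexp : measurable_fun setT (@expR R) by exact: measurable_expR.
have msh : measurable_fun setT (fun t : R => sinhR (t / 2)).
  apply: measurableT_comp.
    by apply: continuous_measurable_fun; exact: continuous_sinhR.
  exact: measurable_funM.
have mJ1 : measurable_fun setT J1.
  apply: measurable_funM => //; apply: measurable_funM => //.
  apply: measurable_funD => //; apply: measurable_funM => //.
  exact: measurableT_comp.
have mJ2 : measurable_fun setT J2.
  apply: measurable_funM => //; apply: measurable_funM => //.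
  by apply: measurable_funD => //; exact: measurable_funM.
have sh0 (t : R) : 0 <= t -> 0 <= sinhR (t / 2).
  rewrite le_eqVlt => /predU1P[<-|t00].
    by rewrite /sinhR mul0r oppr0 subrr mul0r.
  by apply/ltW/sinhR_gt0; lra.
have J10 t : 0 <= t -> 0 <= J1 t.
  move=> t00; rewrite mulr_ge0 ?sh0// mulr_ge0 ?(ltW (q0 _))//.
  by rewrite addr_ge0 ?(ltW b0)// mulr_ge0// expR_ge0.
have J20 t : 0 <= t -> 0 <= J2 t.
  move=> t00; rewrite mulr_ge0 ?sh0// mulr_ge0 ?(ltW (q0 _))//.
  by rewrite addr_ge0 ?(ltW b0)// mulr_ge0// expR_ge0.
have addJ (I J : R -> R) (c : R) : measurable_fun setT I -> measurable_fun setT J ->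
    (forall t, 0 <= I t) -> (forall t, 0 <= t -> 0 <= J t) ->
    (\int[lebesgue_measure]_(t in `[0%R, +oo[) (J t)%:E = c%:E)%E ->
    (\int[lebesgue_measure]_(t in `[0%R, +oo[) (I t + kappa * J t)%:E =
     \int[lebesgue_measure]_(t in `[0%R, +oo[) (I t)%:E + (kappa * c)%:E)%E.
  move=> mI mJ I0 J0 JE; under eq_integral do rewrite EFinD.
  rewrite ge0_integralD//=.
  - congr (_ + _)%E; under eq_integral do rewrite EFinM.
    rewrite ge0_integralZl ?JE//=.
    + exact: measurable_EFin_comp.
    + by move=> t; rewrite in_itv/= andbT lee_fin => /J0.
  - by move=> t _; rewrite lee_fin.
  - exact: measurable_EFin_comp.
  - by move=> t; rewrite in_itv/= andbT lee_fin => /J0 ?; rewrite mulr_ge0.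
  - by apply: measurable_EFin_comp; exact: measurable_funM.
rewrite -(lteD2rE _ _ (x := (kappa * (expR (- (a + b)) / 2))%:E))//.
rewrite -(addJ _ _ _ mI1 mJ1 I10 J10 J1E) -(addJ _ _ _ mI2 mJ2 I20 J20 J2E).
set f1 := fun t => I1 t + kappa * J1 t.
set f2 := fun t => I2 t + kappa * J2 t.
have mf1 : measurable_fun setT f1.
  by apply: measurable_funD => //; exact: measurable_funM.
have mf2 : measurable_fun setT f2.
  by apply: measurable_funD => //; exact: measurable_funM.
pose D : set R := (`[0%R, +oo[%classic `\ 0) `\ t0.
have mD0 : measurable (`[0%R, +oo[%classic `\ (0:R)) by exact: measurableD.
have mD : measurable D by exact: measurableD.
have toD f : measurable_fun setT f ->
  (\int[lebesgue_measure]_(t in `[0%R, +oo[) (f t)%:E =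
   \int[lebesgue_measure]_(t in D) (f t)%:E)%E.
  move=> mf; rewrite /D !integral_setD1//; exact: measurable_EFin_comp.
have f1oo : (\int[lebesgue_measure]_(t in D) (f1 t)%:E < +oo)%E.
  by rewrite -toD// (addJ _ _ _ mI1 mJ1 I10 J10 J1E) lte_add_pinfty// ltry.
rewrite !toD//; apply: ge0_integral_lt => //.
- rewrite gt_eqF//.
  apply: (@lt_le_trans _ _ (lebesgue_measure `]`|t0|, `|t0| + 1])).
    by rewrite lebesgue_measure_itv/= lte_fin ltrDl ltr01 -EFinB lte_fin; lra.
  apply: le_measure; rewrite ?inE//= => t /=; rewrite in_itv/= => /andP[t0t _].
  have n0 := normr_ge0 t0; have := ler_norm t0.
  rewrite /D/= in_itv/= andbT => ?.
  by split; [split|]; [lra| |]; apply/eqP; rewrite gt_eqF; lra.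
- exact: measurable_funTS.
- exact: measurable_funTS.
- move=> t [[/= + _] _]; rewrite in_itv/= andbT => t00.
  by rewrite /f1 addr_ge0// mulr_ge0// J10.
- move=> t [[/= + /eqP tn0] /eqP tt0]; rewrite in_itv/= andbT => t00.
  have tp : 0 < t by rewrite lt_neqAle eq_sym tn0.
  have := lt t tp tt0; rewrite /f1 /f2 /I1 /I2 /J1 /J2 -/(v t); nra.
Qed.


(** * The Bessel function as a mixture integral *)

Lemma integral_expR_minus (R : realType) (C : R) :
  (\int[lebesgue_measure]_(t in `[0%R, +oo[) (expR (C - t))%:E = (expR C)%:E)%E.
Proof.
pose F (t : R) := - expR (C - t).
have dF (t : R) : is_derive t 1 F (expR (C - t)).
  rewrite /F; apply: is_derive_eq.
  by rewrite /GRing.scale /=; ring.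
have cF : continuous F.
  by move=> z; apply/differentiable_continuous/derivable1_diffP; case: (dF z).
have cf : continuous (fun t : R => expR (C - t)).
  move=> z; apply/differentiable_continuous/derivable1_diffP.
  exact: ex_derive.
have -> : expR C = 0 - F 0 by rewrite /F sub0r opprK subr0.
rewrite EFinB; apply: ge0_continuous_FTC2y.
- by move=> t t0; exact: expR_ge0.
- exact: continuous_subspaceT.
- rewrite -oppr0; apply: cvgN; apply: (@expR_cvg0 _ _ C 1) => // t t0; lra.
- by move=> t _; case: (dF t).
- exact/cvg_at_right_filter/cF.
- by move=> t _; rewrite derive1E derive_val.
Qed.

(** Finiteness matters because [besselK] would be 0, by the convention for real
    valued integrals, if this extended real integral were infinite. *)
Lemma besselK_integral_lty (R : realType) (nu x : R) : 0 < x ->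
  (\int[lebesgue_measure]_(t in `[0%R, +oo[)
    (expR (- (x * coshR t)) * coshR (nu * t))%:E < +oo)%E.
Proof.
move=> x0.
have [C HC] := linear_minus_expR_le `|nu| (divr_gt0 x0 (ltr0n R 2)).
apply: (@le_lt_trans _ _ (\int[lebesgue_measure]_(t in `[0%R, +oo[)
   (expR (C - t))%:E)%E); last by rewrite integral_expR_minus ltry.
have mcosh := @measurable_coshR R.
apply: ge0_le_integral => //=.
- by move=> t _; rewrite lee_fin mulr_ge0 ?expR_ge0// divr_ge0// addr_ge0 ?expR_ge0.
- apply: measurable_EFin_comp; apply: measurable_funM.
    apply: measurableT_comp => //; apply: measurableT_comp => //.
    exact: measurable_funM.
  by apply: measurableT_comp => //; exact: measurable_funM.
- apply: measurable_EFin_comp; apply: measurableT_comp => //.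
  exact: measurable_funB.
- move=> t; rewrite in_itv/= andbT lee_fin => t0.
  apply: (@le_trans _ _ (expR (- (x / 2 * expR t)) * expR (`|nu| * t))).
    apply: ler_pM; rewrite ?expR_ge0//.
    + by rewrite divr_ge0// addr_ge0 ?expR_ge0.
    + rewrite ler_expR lerN2 /coshR; have := expR_ge0 (- t); nra.
    + have n1 : expR (nu * t) <= expR (`|nu| * t).
        by rewrite ler_expR ler_wpM2r// ler_norm.
      have n2 : expR (- (nu * t)) <= expR (`|nu| * t).
        by rewrite ler_expR -mulNr ler_wpM2r// -normrN ler_norm.
      by rewrite /coshR; lra.
  by rewrite -expRD ler_expR addrC; exact: HC.
Qed.

Lemma besselK_integralT (R : realType) (nu x : R) : 0 < x ->
  (\int[lebesgue_measure]_t (expR (nu * t - x * coshR t))%:E =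
   (2 * besselK nu x)%:E)%E.
Proof.
move=> x0.
have mcosh := @measurable_coshR R.
rewrite ge0_integral_fold; last 2 first.
- apply/measurable_EFinP; apply: measurableT_comp => //.
  by apply: measurable_funB; exact: measurable_funM.
- by move=> t; rewrite lee_fin expR_ge0.
have pos (t : R) : (0 <= (expR (- (x * coshR t)) * coshR (nu * t))%:E)%E.
  by rewrite lee_fin mulr_ge0 ?expR_ge0// divr_ge0// addr_ge0 ?expR_ge0.
transitivity (\int[lebesgue_measure]_(t in `[0%R, +oo[)
    (2%:E * (expR (- (x * coshR t)) * coshR (nu * t))%:E))%E.
  apply: eq_integral => t _; rewrite coshRN -EFinD -EFinM; congr EFin.
  by rewrite mulrN !expRD /(coshR (nu * t)); field.
rewrite ge0_integralZl//=; last first.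
  apply: measurable_EFin_comp; apply: measurable_funM.
    apply: measurableT_comp => //; apply: measurableT_comp => //.
    exact: measurable_funM.
  by apply: measurableT_comp => //; exact: measurable_funM.
rewrite EFinM; congr (_ * _)%E.
rewrite /besselK /Rintegral fineK//.
rewrite ge0_fin_numE ?besselK_integral_lty//.
by apply: integral_ge0.
Qed.

(** Translating the variable by ln (w * alpha / y) moves the dependence on y
    from the scale of the hyperbolic cosine to the coefficient of expR (- t)
    alone, which is what makes the integrand Gaussian in x when y^2 = delta^2 +
    x^2. *)
Lemma besselK_mixture (R : realType) (nu alpha y w : R) :
  0 < alpha -> 0 < y -> 0 < w ->
  (((y / alpha) `^ nu * besselK nu (alpha * y))%:E =
   (w `^ nu / 2)%:E * \int[lebesgue_measure]_t
     (expR (nu * t - (alpha ^+ 2 * w * expR t + y ^+ 2 * expR (- t) / w) / 2))%:E)%E.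
Proof.
move=> alpha0 y0 w0.
pose c := ln (w * alpha / y).
have cE : expR c = w * alpha / y by rewrite lnK// posrE divr_gt0// mulr_gt0.
have ya0 : 0 < y / alpha by exact: divr_gt0.
have mcosh := @measurable_coshR R.
have := besselK_integralT nu (mulr_gt0 alpha0 y0).
rewrite (ge0_integral_affine (a := 1) c)//; last first.
  apply: measurable_EFin_comp; apply: measurableT_comp => //.
  by apply: measurable_funB; exact: measurable_funM.
rewrite mul1e preimage_setT.
under eq_integral => t _.
  rewrite mul1r.
  have -> : nu * (t + c) - alpha * y * coshR (t + c) = nu * c +
      (nu * t - (alpha ^+ 2 * w * expR t + y ^+ 2 * expR (- t) / w) / 2).
    rewrite /coshR opprD !expRD !(expRN c) cE; field.
    by rewrite !gt_eqF.
  rewrite expRD EFinM; over.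
rewrite ge0_integralZl//=; last first.
  apply: measurable_EFin_comp; apply: measurableT_comp => //.
  apply: measurable_funB; first exact: measurable_funM.
  apply: measurable_funM => //; apply: measurable_funD; first exact: measurable_funM.
  apply: measurable_funM => //; apply: measurable_funM => //.
  exact: measurableT_comp.
set I := (\int[_]_t _)%E => IE.
have cw : expR (nu * c) * (y / alpha) `^ nu = w `^ nu.
  rewrite /powR !gt_eqF// -expRD -mulrDr; congr (expR (_ * _)).
  rewrite -lnM ?posrE ?divr_gt0 ?mulr_gt0//; congr ln; field.
  by rewrite !gt_eqF.
transitivity (((y / alpha) `^ nu / 2)%:E * ((expR (nu * c))%:E * I))%E.
  by rewrite IE -EFinM; congr EFin; field.
by rewrite muleA -EFinM; congr (_%:E * _)%E; rewrite -cw; ring.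
Qed.


(** * The generalized hyperbolic law as a normal mixture *)

(** The joint density of X and t, up to a constant factor. *)
Definition gh_kernel (R : realType) (lambda alpha beta delta w x t : R) : R :=
  expR (beta * x + ((lambda - 1 / 2) * t -
    (alpha ^+ 2 * w * expR t + (delta ^+ 2 + x ^+ 2) * expR (- t) / w) / 2)).

Lemma measurable_gh_kernel (R : realType) (lambda alpha beta delta w : R) :
  measurable_fun setT (fun z : R * R =>
    gh_kernel lambda alpha beta delta w z.1 z.2).
Proof.
have m1 : measurable_fun setT (fun z : R * R => z.1) by exact: measurable_fst.
have m2 : measurable_fun setT (fun z : R * R => z.2) by exact: measurable_snd.
apply: measurableT_comp => //; apply: measurable_funD; first exact: measurable_funM.
apply: measurable_funB; first exact: measurable_funM.
apply: measurable_funM => //; apply: measurable_funD.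
  by apply: measurable_funM => //; exact: measurableT_comp.
apply: measurable_funM => //; apply: measurable_funM.
  by apply: measurable_funD => //; exact: measurable_funX.
by apply: measurableT_comp => //; exact: measurableT_comp.
Qed.

(** The point 0 is excluded because for delta = 0 the value of the density
    there does not follow the mixture formula. *)
Lemma gh_pdf_mixture (R : realType) (lambda alpha beta delta w : R) :
  0 < alpha -> 0 <= delta -> 0 < w ->
  exists2 C : R, 0 <= C & forall x, x != 0 ->
    ((gh_pdf lambda alpha beta delta x)%:E =
    C%:E * \int[lebesgue_measure]_t
      (gh_kernel lambda alpha beta delta w x t)%:E)%E.
Proof.
move=> alpha0 delta0 w0.
have bK (nu x : R) : 0 <= besselK nu x.
  rewrite /besselK Rintegral_ge0// => t _.
  by rewrite mulr_ge0 ?expR_ge0// divr_ge0// addr_ge0 ?expR_ge0.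
have main (c x : R) : 0 < delta ^+ 2 + x ^+ 2 ->
    let y := Num.sqrt (delta ^+ 2 + x ^+ 2) in
    ((c * expR (beta * x) * ((y / alpha) `^ (lambda - 1 / 2) *
       besselK (lambda - 1 / 2) (alpha * y)))%:E =
    (c * (w `^ (lambda - 1 / 2) / 2))%:E * \int[lebesgue_measure]_t
      (gh_kernel lambda alpha beta delta w x t)%:E)%E.
  move=> y2 y.
  have y0 : 0 < y by rewrite sqrtr_gt0.
  rewrite [LHS]EFinM (besselK_mixture _ alpha0 y0 w0).
  under [in RHS]eq_integral do rewrite /gh_kernel expRD EFinM.
  rewrite ge0_integralZl//=; last first.
    apply: measurable_EFin_comp; apply: measurableT_comp => //.
    apply: measurable_funB; first exact: measurable_funM.
    apply: measurable_funM => //; apply: measurable_funD; first exact: measurable_funM.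
    apply: measurable_funM => //; apply: measurable_funM => //.
    exact: measurableT_comp.
  rewrite sqr_sqrtr ?(ltW y2)// !muleA -!EFinM; congr (_%:E * _)%E.
  ring.
have y2 (x : R) : x != 0 -> 0 < delta ^+ 2 + x ^+ 2.
  by move=> x0; rewrite ltr_wpDl ?sqr_ge0// exprn_even_gt0.
pose g := gh_gamma alpha beta.
have [d0|dn0] := eqVneq delta 0.
  exists (2 `^ (1 - lambda) * g `^ (2 * lambda) / (Num.sqrt (2 * pi) * gammaR lambda)
    * (w `^ (lambda - 1 / 2) / 2)).
    rewrite mulr_ge0 ?divr_ge0 ?mulr_ge0 ?powR_ge0 ?sqrtr_ge0//.
    rewrite /gammaR Rintegral_ge0// => t _.
    by rewrite mulr_ge0 ?expR_ge0 ?powR_ge0.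
  move=> x x0; rewrite -main ?y2// /gh_pdf d0 eqxx -/g.
  by rewrite expr0n add0r sqrtr_sqr; congr EFin; ring.
exists ((g / delta) `^ lambda / (Num.sqrt (2 * pi) * besselK lambda (delta * g))
    * (w `^ (lambda - 1 / 2) / 2)).
  by rewrite mulr_ge0 ?divr_ge0 ?mulr_ge0 ?powR_ge0 ?sqrtr_ge0.
move=> x x0; rewrite -main ?y2// /gh_pdf (negbTE dn0) -/g.
congr EFin; congr (_ * _); rewrite mulrC; congr (_ * _).
by rewrite -powRN; congr (_ `^ _); ring.
Qed.

(** Completing the square: given t, the variable X is normal with mean beta *
    s^2 and standard deviation s. *)
Lemma gh_kernel_gauss (R : realType) (lambda alpha beta delta w t z : R) :
  0 < w ->
  let s := Num.sqrt w * expR (t / 2) in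
  s * gh_kernel lambda alpha beta delta w (s * z + beta * s ^+ 2) t =
  Num.sqrt w / normal_peak 1 * gig_weight lambda (delta ^+ 2 / (2 * w))
    ((alpha ^+ 2 - beta ^+ 2) * w / 2) t * normal_pdf 0 1 z.
Proof.
move=> w0 s.
have p0 : normal_peak (1 : R) != 0 by rewrite gt_eqF// normal_peak_gt0 ?oner_eq0.
have s2 : s ^+ 2 = w * expR t.
  by rewrite exprMn sqr_sqrtr ?ltW// expr2 -expRD -splitr.
have s0 : s != 0 by rewrite gt_eqF// mulr_gt0 ?sqrtr_gt0 ?expR_gt0.
rewrite std_pdfE.
rewrite [RHS](_ : _ = Num.sqrt w * (gig_weight lambda (delta ^+ 2 / (2 * w))
    ((alpha ^+ 2 - beta ^+ 2) * w / 2) t * expR (- (z ^+ 2 / 2)))); last by field.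
rewrite {1}/s -mulrA; congr (_ * _).
rewrite /gig_weight /gh_kernel -!expRD; congr expR.
have -> : expR t = s ^+ 2 / w by rewrite s2; field; rewrite gt_eqF.
have -> : expR (- t) = w / s ^+ 2.
  by rewrite expRN s2; field; rewrite !gt_eqF ?expR_gt0.
by field; rewrite s0 gt_eqF.
Qed.

Lemma integral_gh_kernel (R : realType) (lambda alpha beta delta w t : R)
    (A : set R) : 0 < w -> measurable A ->
  let s := Num.sqrt w * expR (t / 2) in
  (\int[lebesgue_measure]_(x in A)
    (gh_kernel lambda alpha beta delta w x t)%:E =
  (Num.sqrt w / normal_peak 1)%:E *
  ((gig_weight lambda (delta ^+ 2 / (2 * w))
    ((alpha ^+ 2 - beta ^+ 2) * w / 2) t)%:E *
  normal_prob (0 : R) 1 ((fun z => s * z + beta * s ^+ 2)%R @^-1` A)))%E.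
Proof.
move=> w0 mA s.
have s0 : 0 < s by rewrite mulr_gt0 ?sqrtr_gt0 ?expR_gt0.
have sw0 : 0 <= Num.sqrt w / normal_peak 1.
  by rewrite divr_ge0 ?sqrtr_ge0 ?normal_peak_ge0.
have mpre : measurable ((fun z => s * z + beta * s ^+ 2) @^-1` A).
  rewrite -[X in measurable X]setTI.
  have : measurable_fun setT (fun z : R => s * z + beta * s ^+ 2).
    by apply: measurable_funD => //; exact: measurable_funM.
  by apply.
have mk D : measurable_fun D
    (fun x : R => (gh_kernel lambda alpha beta delta w x t)%:E).
  apply: measurable_EFin_comp; apply: measurableT_comp => //.
  apply: measurable_funD; first exact: measurable_funM.
  apply: measurable_funB => //; apply: measurable_funM => //.
  apply: measurable_funD => //; apply: measurable_funM => //.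
  apply: measurable_funM => //; apply: measurable_funD => //.
rewrite (ge0_integral_affine (beta * s ^+ 2) s0)//; last first.
  by move=> x; rewrite lee_fin expR_ge0.
rewrite -ge0_integralZl//=; last 3 first.
- rewrite /gh_kernel.
  apply: measurable_EFin_comp; apply: measurableT_comp => //.
  have ms : measurable_fun setT (fun z : R => s * z + beta * s ^+ 2).
    by apply: measurable_funD => //; exact: measurable_funM.
  apply: measurable_funD; first exact: measurable_funM.
  apply: measurable_funB => //; apply: measurable_funM => //.
  apply: measurable_funD => //; apply: measurable_funM => //.
  apply: measurable_funM => //; apply: measurable_funD => //.
  exact: measurable_funX.
- by move=> x _; rewrite lee_fin expR_ge0.
- by rewrite lee_fin ltW.
under eq_integral do rewrite -EFinM (gh_kernel_gauss _ _ _ _ _ _ w0) EFinM.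
rewrite ge0_integralZl//=; last 3 first.
- exact: measurable_EFin_normal_pdf.
- by move=> x _; rewrite lee_fin normal_pdf_ge0.
- by rewrite lee_fin mulr_ge0// expR_ge0.
by rewrite EFinM -muleA.
Qed.

Lemma gh_prob_mixture (R : realType) (lambda alpha beta delta w : R) :
  0 < alpha -> 0 <= delta -> 0 < w ->
  exists2 C : R, 0 <= C & forall A : set R, measurable A ->
    let s t := Num.sqrt w * expR (t / 2) in
    (gh_prob lambda alpha beta delta A = C%:E * \int[lebesgue_measure]_t
      ((Num.sqrt w / normal_peak 1)%:E * ((gig_weight lambda (delta ^+ 2 / (2 * w))
        ((alpha ^+ 2 - beta ^+ 2) * w / 2) t)%:E *
       normal_prob (0 : R) 1
         ((fun z => s t * z + beta * s t ^+ 2)%R @^-1` A))))%E.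
Proof.
move=> alpha0 delta0 w0.
have [C C0 pdfE] := gh_pdf_mixture lambda beta alpha0 delta0 w0.
exists C => // A mA s.
pose k (z : measurableTypeR R * measurableTypeR R) :=
  gh_kernel lambda alpha beta delta w z.1 z.2.
have mk : measurable_fun setT k by exact: measurable_gh_kernel.
have k0 z : 0 <= k z by exact: expR_ge0.
have k0E z : (0 <= (k z)%:E)%E by rewrite lee_fin.
have mK : measurable_fun setT (fun x : measurableTypeR R =>
    \int[@lebesgue_measure R]_t (k (x, t))%:E)%E.
  have mkE : measurable_fun setT (EFin \o k) by exact/measurable_EFinP.
  exact: (measurable_fun_fubini_tonelli_F (m2 := @lebesgue_measure R)
    (EFin \o k) mkE k0E).
have mCK : measurable_fun setT (fun x : R =>
    C%:E * \int[@lebesgue_measure R]_t (k (x, t))%:E)%E.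
  exact: measurable_funeM.
have mA0 : measurable (A `\ 0) by exact: measurableD.
have pE x : x \in A `\ 0 -> ((gh_pdf lambda alpha beta delta x)%:E =
   C%:E * \int[@lebesgue_measure R]_t (k (x, t))%:E)%E.
  by rewrite inE => -[_ /eqP /= x0]; exact: pdfE.
(* Removing the null set {0} makes the mixture formula available everywhere. *)
rewrite /gh_prob -(integral_setD1 (r := 0))//; last first.
  apply: (eq_measurable_fun _ (fun x xA => esym (pE x xA))).
  exact: measurable_funTS.
under eq_integral => x xA do rewrite (pE x xA).
rewrite integral_setD1//; last exact: measurable_funTS.
rewrite ge0_integralZl//; last 2 first.
- exact: measurable_funTS.
- by move=> x _; exact: integral_ge0.
rewrite (ge0_integral_exchange lebesgue_measure lebesgue_measure mA mk k0).
under eq_integral do rewrite /k/= (integral_gh_kernel _ _ _ _ _ w0 mA).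
by [].
Qed.

(** The threshold beta * w is special because its standardization is odd in
    t. *)
Lemma gh_prob_split (R : realType) (lambda alpha beta delta w : R) :
  0 < alpha -> 0 <= delta -> 0 < w ->
  let q := gig_weight lambda (delta ^+ 2 / (2 * w))
    ((alpha ^+ 2 - beta ^+ 2) * w / 2) in
  let v t := 2 * beta * Num.sqrt w * sinhR (t / 2) in
  exists2 C : R, 0 <= C &
    (gh_prob lambda alpha beta delta `]-oo, (beta * w)%R] =
      C%:E * \int[lebesgue_measure]_t (q t * std_cdf (- v t))%:E /\
     gh_prob lambda alpha beta delta `](beta * w)%R, +oo[ =
      C%:E * \int[lebesgue_measure]_t (q t * std_cdf (v t))%:E)%E.
Proof.
move=> alpha0 delta0 w0 q v.
have [C C0 CE] := gh_prob_mixture lambda beta alpha0 delta0 w0.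
pose c := Num.sqrt w / normal_peak (1 : R).
have c0 : 0 <= c by rewrite divr_ge0 ?sqrtr_ge0// normal_peak_ge0.
have q0 t : 0 <= q t by exact: expR_ge0.
have mq : measurable_fun setT q.
  by apply: continuous_measurable_fun; exact: continuous_gig_weight.
have mP : measurable_fun setT (@std_cdf R).
  by apply: continuous_measurable_fun; exact: continuous_std_cdf.
have mv : measurable_fun setT v.
  apply: measurable_funM => //; apply: measurableT_comp.
    by apply: continuous_measurable_fun; exact: continuous_sinhR.
  exact: measurable_funM.
have pull (f : R -> R) : measurable_fun setT f -> (forall t, 0 <= f t) ->
    (C%:E * \int[lebesgue_measure]_t (c%:E * (f t)%:E) =
     (C * c)%:E * \int[lebesgue_measure]_t (f t)%:E)%E.
  move=> mf f0; rewrite [in RHS]EFinM -[RHS](muleA C%:E c%:E); congr (_ * _)%E.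
  rewrite ge0_integralZl//.
  - exact/measurable_EFinP.
  - by move=> t _; rewrite lee_fin.
have above t z : let s := Num.sqrt w * expR (t / 2) in
    (beta * w < s * z + beta * s ^+ 2) = (- v t < z).
  move=> s; have s0 : 0 < s by rewrite mulr_gt0 ?sqrtr_gt0 ?expR_gt0.
  rewrite -[RHS](ltr_pM2l s0) -ltrBlDr; congr (_ < _).
  have eN : expR (t / 2) * expR (- (t / 2)) = 1 by rewrite -expRD subrr expR0.
  have sw : Num.sqrt w * Num.sqrt w = w by rewrite -expr2 sqr_sqrtr ?ltW.
  rewrite /v /sinhR /s.
  transitivity (beta * ((Num.sqrt w * Num.sqrt w) * (expR (t / 2) * expR (- (t / 2)))
    - (Num.sqrt w * expR (t / 2)) ^+ 2)); first by rewrite sw eN mulr1; ring.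
  by field.
exists (C * c); first by rewrite mulr_ge0.
split.
- rewrite CE// -pull; last 2 first.
  + apply: measurable_funM => //; apply: measurableT_comp => //.
    exact: measurableT_comp.
  + by move=> t; rewrite mulr_ge0 ?std_cdf_ge0.
  congr (_ * _)%E; apply: eq_integral => t _.
  rewrite (EFinM (q t)) std_cdfE -/c -/q; congr (_ * (_ * normal_prob _ _ _))%E.
  apply/seteqP; split => z; rewrite /= !in_itv/= !leNgt => h;
    by rewrite above in h *.
- rewrite CE// -pull; last 2 first.
  + by apply: measurable_funM => //; exact: measurableT_comp.
  + by move=> t; rewrite mulr_ge0 ?std_cdf_ge0.
  congr (_ * _)%E; apply: eq_integral => t _.
  rewrite (EFinM (q t)) -[v t]opprK -normal_prob_tail -/c -/q.
  congr (_ * (_ * normal_prob _ _ _))%E.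
  by apply/seteqP; split => z; rewrite /= !in_itv/= !andbT above.
Qed.


(** * The median *)

(** By right continuity the distribution function stays below 1/2 up to some
    e > m, so that e is a lower bound of the set defining the median. *)
Lemma median_gt d (T : measurableType d) (R : realType) (P : probability T R)
    (X : {RV P >-> R}) (m : R) :
  (cdf X m < (1 / 2)%:E)%E -> m < median X.
Proof.
move=> Xm.
have cdfE x : (fine (cdf X x))%:E = cdf X x by rewrite fineK// fin_num_measure.
have rc : fine (cdf X x) @[x --> m^'+] --> fine (cdf X m).
  by apply: fine_cvg; rewrite cdfE; exact: cdf_right_continuous.
have toinf : fine (cdf X x) @[x --> +oo] --> (1 : R).
  by apply: fine_cvg; exact: cvg_cdfy1.
have Xm' : fine (cdf X m) < 1 / 2 by rewrite -lte_fin cdfE.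
have h1 : (1 / 2 : R) < 1 by lra.

have right : \forall x \near m^'+, fine (cdf X x) < 1 / 2 /\ m < x.
  near=> x; split; last by near: x; exact: nbhs_right_gt.
  by near: x; exact: (cvgr_lt _ rc).
have [e [Xe me]] := @filter_ex _ m^'+ (at_right_proper_filter m) _ right.
apply: (lt_le_trans me); apply: lb_le_inf.
  have top : \forall x \near +oo, 1 / 2 < fine (cdf X x) by exact: (cvgr_gt _ toinf).
  have [x /ltW hx] := @filter_ex _ +oo%R _ _ top; exists x => /=.
  by rewrite -cdfE lee_fin.
move=> x /= hx; rewrite leNgt; apply/negP => xe.
have := cdf_nondecreasing X (ltW xe); rewrite leNgt; apply/negP; rewrite negbK.
by rewrite (lt_le_trans _ hx)// -cdfE lte_fin.
Unshelve. all: by end_near. Qed.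

Theorem theorem2p6 (R : realType) (d : measure_display) (T : measurableType d)
    (P : probability T R) (X : {RV P >-> R}) (lambda alpha beta delta : R)
    (beta_gt0 : 0 < beta) (alpha_gt_beta : beta < alpha)
    (delta_lambda : 0 < delta \/ (delta = 0 /\ 1 / 2 < lambda))
    (X_GH : forall A : set R, measurable A ->
       distribution P X A = gh_prob lambda alpha beta delta A) :
  let gamma := gh_gamma alpha beta in
  median X > beta / gamma ^+ 2 *
    (lambda - 1 / 2
     + Num.sqrt ((lambda - 1 / 2) ^+ 2 + delta ^+ 2 * gamma ^+ 2)).
Proof.
pose gamma := gh_gamma alpha beta; pose nu := lambda - 1 / 2.
suff : beta / gamma ^+ 2 * (nu + Num.sqrt (nu ^+ 2 + delta ^+ 2 * gamma ^+ 2)) <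
  median X by [].
have alpha0 : 0 < alpha by exact: lt_trans alpha_gt_beta.
have ab0 : 0 < alpha ^+ 2 - beta ^+ 2 by nra.
have g2 : gamma ^+ 2 = alpha ^+ 2 - beta ^+ 2 by rewrite sqr_sqrtr// ltW.
have g0 : 0 < gamma ^+ 2 by rewrite g2.
have delta0 : 0 <= delta by case: delta_lambda => [/ltW//|[->]].
set r := Num.sqrt _.
have r2 : r ^+ 2 = nu ^+ 2 + delta ^+ 2 * gamma ^+ 2.
  by rewrite sqr_sqrtr// addr_ge0 ?sqr_ge0// mulr_ge0 ?sqr_ge0.
have r0 : 0 <= r by exact: sqrtr_ge0.
have nr0 : 0 < nu + r.
  case: delta_lambda => [d0|[_ l2]]; last by rewrite ltr_pwDl// /nu; lra.
  have : 0 < delta ^+ 2 * gamma ^+ 2 by rewrite mulr_gt0// exprn_gt0.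
  by rewrite ltNge => ?; apply/negP => ?; nra.
pose w := (nu + r) / gamma ^+ 2.
have w0 : 0 < w by exact: divr_gt0.
have wE : gamma ^+ 2 * w = nu + r by rewrite /w mulrC divfK// gt_eqF.
have -> : beta / gamma ^+ 2 * (nu + r) = beta * w by rewrite /w; ring.
pose a := delta ^+ 2 / (2 * w); pose b := (alpha ^+ 2 - beta ^+ 2) * w / 2.
have a0 : 0 <= a by rewrite divr_ge0 ?sqr_ge0// mulr_ge0// ltW.
have b0 : 0 < b by rewrite divr_gt0// mulr_gt0.
(* The quadratic equation satisfied by w, divided by 2 * w. *)
have ba : b - a = nu.
  have aw : 2 * a * w = delta ^+ 2 by rewrite /a; field; rewrite gt_eqF.
  have aE : 2 * a = r - nu.
    have : (2 * a) * (nu + r) = (r - nu) * (nu + r).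
      rewrite -wE mulrCA aw wE; transitivity (r ^+ 2 - nu ^+ 2); last ring.
      by rewrite r2; ring.
    by move/mulIf; apply; rewrite gt_eqF.
  by rewrite /b -g2 wE; lra.
have k0 : 0 < 2 * beta * Num.sqrt w by rewrite !mulr_gt0 ?sqrtr_gt0.
have lt := gig_normal_lt a0 b0 ba k0.
have [C C0 [lowE uppE]] := gh_prob_split lambda beta alpha0 delta0 w0.
rewrite -X_GH// -/a -/b in lowE; rewrite -X_GH// -/a -/b in uppE.
rewrite /= in lt.
set Il := (\int[_]_t _)%E in lt lowE.
set Iu := (\int[_]_t _)%E in lt uppE.
have sum1 : (distribution P X `]-oo, (beta * w)%R] +
             distribution P X `](beta * w)%R, +oo[ = 1)%E.
  rewrite -(probability_setT (distribution P X)) -measureU//.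
  - by rewrite -setCitvl setUv.
  - by rewrite -setCitvl setICr.
apply: median_gt; rewrite /cdf.
have low_upp : (distribution P X `]-oo, (beta * w)%R] <
                distribution P X `](beta * w)%R, +oo[)%E.
  have Il0 : (0 <= Il)%E.
    by apply: integral_ge0 => t _; rewrite lee_fin mulr_ge0 ?std_cdf_ge0 ?expR_ge0.
  have Iu0 : (0 <= Iu)%E.
    by apply: integral_ge0 => t _; rewrite lee_fin mulr_ge0 ?std_cdf_ge0 ?expR_ge0.
  (* With C = 0 both probabilities would vanish, and they add up to 1. *)
  have Cp : 0 < C.
    rewrite lt_neqAle C0 andbT; apply/eqP => C00.
    move: sum1; rewrite lowE uppE -C00 !mul0e adde0 => /eqP.
    by rewrite eqe eq_sym oner_eq0.
  rewrite lowE uppE lte_pmul2l ?lte_fin//; apply: lt.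
  rewrite ltey; apply/eqP => Iloo.
  have : (distribution P X `]-oo, (beta * w)%R] <= 1)%E by exact: probability_le1.
  by rewrite lowE Iloo gt0_muley ?lte_fin// leye_eq.
have fl : distribution P X `]-oo, (beta * w)%R] \is a fin_num.
  exact: fin_num_measure.
have fu : distribution P X `](beta * w)%R, +oo[ \is a fin_num.
  exact: fin_num_measure.
move: sum1 low_upp; rewrite -(fineK fl) -(fineK fu) -EFinD !lte_fin => -[] ? ?.
lra.
Qed.
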